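(* Let $\boldsymbol{\pi}\in\mathbb{R}^n$ be a vector with positive entries such that $\boldsymbol{\pi}^T\mathbf{1}=1$, and let $S\in\mathbb{S}_n^{\boldsymbol{\pi}}$. The orthogonal projection $\Pi_S:\mathbb{R}^{n\times n}\to\mathcal{T}_S \mathbb{S}_n^{\boldsymbol{\pi}}$, with respect to the Fisher inner product $\langle\cdot,\cdot\rangle_S$, of a matrix $Z\in\mathbb{R}^{n\times n}$ has the expression $$\Pi_S(Z) = Z - (\boldsymbol{\alpha} \mathbf{1}^T + \boldsymbol{\pi}\boldsymbol{\beta}^T)\odot S,$$ where the vectors $\boldsymbol{\alpha},\boldsymbol{\beta}\in\mathbb{R}^n$ are a solution to the following consistent linear system: $$\begin{bmatrix} Z\mathbf{1} \\ Z^T \boldsymbol{\pi} \end{bmatrix}=\begin{bmatrix} I & D_{\boldsymbol{\pi}} S \\ S^T D_{\boldsymbol{\pi}} & \mathrm{diag}(S^T D_{\boldsymbol{\pi}} \boldsymbol{\pi}) \end{bmatrix}\begin{bmatrix}\boldsymbol{\alpha}\\ \boldsymbol{\beta}\end{bmatrix},\qquad D_{\boldsymbol{\pi}} = \operatorname{diag}(\boldsymbol{\pi}).$$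
   Context: $\mathbf{1}=(1,\ldots,1)^T\in\mathbb{R}^n$; $\odot$ and $\oslash$ denote entrywise (Hadamard) multiplication and division; for a vector $\mathbf{x}$, $\operatorname{diag}(\mathbf{x})$ is the diagonal matrix with the entries of $\mathbf{x}$ on the diagonal; $S>0$ means all entries are positive. $\mathbb{S}_n^{\boldsymbol{\pi}} = \{ S \in \mathbb{R}^{n \times n} : S \mathbf{1} = \mathbf{1},\ \boldsymbol{\pi}^T S = \boldsymbol{\pi}^T,\ S > 0 \}$ is an embedded submanifold of $\mathbb{R}^{n\times n}$ whose tangent space at $S$ is $\mathcal{T}_S \mathbb{S}_n^{\boldsymbol{\pi}} = \{ \xi \in \mathbb{R}^{n \times n} : \xi \mathbf{1} = \mathbf{0},\ \boldsymbol{\pi}^T \xi = \mathbf{0}^T \}$. The Fisher inner product at $S$ is $\langle \xi,\eta\rangle_S=\sum_{i,j=1}^n \frac{\xi_{i,j}\eta_{i,j}}{S_{i,j}}=\operatorname{Trace}((\xi\oslash S)\eta^T)$ for $\xi,\eta\in\mathbb{R}^{n\times n}$. *)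

(* Defs.v *)
From mathcomp Require Import all_boot all_order all_algebra.
From mathcomp Require Import classical_sets reals.

Set Implicit Arguments.
Unset Strict Implicit.
Unset Printing Implicit Defensive.

Import Order.TTheory GRing.Theory Num.Theory.

Local Open Scope classical_set_scope.
Local Open Scope ring_scope.

Definition ones (R : realType) (n : nat) : 'cV[R]_n := const_mx 1.

Definition hadamard (R : realType) (m n : nat) (A B : 'M[R]_(m, n)) :
  'M[R]_(m, n) := map2_mx (fun x y : R => x * y) A B.

(* [diag_mx] expects a row vector. *)
Definition diag_col (R : realType) (n : nat) (x : 'cV[R]_n) : 'M[R]_n :=
  diag_mx x^T.

Definition stoch_manifold (R : realType) (n : nat) (p : 'cV[R]_n) :
  set 'M[R]_n :=
  [set S | [/\ S *m ones R n = ones R n,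
               p^T *m S = p^T
             & forall i j, 0 < S i j]].

(* The tangent space is the same linear space at every point of the manifold,
   so no base point appears. *)
Definition tangent_space (R : realType) (n : nat) (p : 'cV[R]_n) :
  set 'M[R]_n :=
  [set xi | xi *m ones R n = 0 /\ p^T *m xi = 0].

Definition fisher (R : realType) (n : nat) (S xi eta : 'M[R]_n) : R :=
  \sum_(i < n) \sum_(j < n) xi i j * eta i j / S i j.

Definition orthogonal_projection (R : realType) (V : lmodType R)
  (ip : V -> V -> R) (T : set V) (P : V -> V) : Prop :=
  forall z : V, T (P z) /\ (forall x : V, T x -> ip (z - P z) x = 0).

(* The block system whose solutions (a, b) parametrize the normal component. *)
Definition normal_system (R : realType) (n : nat) (p : 'cV[R]_n)
  (S Z : 'M[R]_n) (a b : 'cV[R]_n) : Prop :=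
  let D := diag_col p in
  col_mx (Z *m ones R n) (Z^T *m p) =
  block_mx 1%:M       (D *m S)
           (S^T *m D) (diag_col (S^T *m D *m p)) *m col_mx a b.

(* Main.v *)
Require Import Defs.
From mathcomp Require Import all_boot all_order all_algebra.
From mathcomp Require Import classical_sets reals boolp.
From mathcomp Require Import ring.

Set Implicit Arguments.
Unset Strict Implicit.
Unset Printing Implicit Defensive.

Import Order.TTheory GRing.Theory Num.Theory.

Local Open Scope classical_set_scope.
Local Open Scope ring_scope.

(** The linear map A : (a, b) |-> (a 1^T + p b^T) o S has, for the Fisher inner
product at S, the adjoint A* : X |-> (X 1, X^T p) ([fisher_normal_mx]).  The
tangent space is the kernel of A*, hence the orthogonal complement of the image
of A, and the block system reads A* A (a, b) = A* Z: these are the normal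
equations of the projection.  Therefore (a, b) solves the system exactly when
Z - A (a, b) is tangent ([normal_system_tangent]), and then Z - A (a, b) is the
projection of Z, since A (a, b) is orthogonal to every tangent vector.

Normal equations are always consistent ([normal_systemP]): a vector k that
annihilates the image of A* A satisfies <A k, A k> = k^T A* A k = 0, so A k = 0
because the Fisher form is positive definite, whence k^T A* Z = <A k, Z> = 0.
Positive definiteness also makes the projection unique. *)

(** The normal vector (a 1^T + p b^T) o S with multipliers a and b. *)
Definition normal_mx (R : realType) (n : nat) (p : 'cV[R]_n) (S : 'M[R]_n)
  (a b : 'cV[R]_n) : 'M[R]_n := hadamard (a *m (ones R n)^T + p *m b^T) S.

(** The row sums X 1 stacked over the [p]-weighted column sums X^T p. *)
Definition margins (R : realType) (n : nat) (p : 'cV[R]_n) (X : 'M[R]_n) :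
  'cV[R]_(n + n) := col_mx (X *m ones R n) (X^T *m p).

(** The matrix of the block system. *)
Definition normal_block (R : realType) (n : nat) (p : 'cV[R]_n)
  (S : 'M[R]_n) : 'M[R]_(n + n) :=
  block_mx 1%:M (diag_col p *m S)
    (S^T *m diag_col p) (diag_col (S^T *m diag_col p *m p)).

Lemma normal_mxE (R : realType) (n : nat) (p : 'cV[R]_n) (S : 'M[R]_n)
  (a b : 'cV[R]_n) i j :
  normal_mx p S a b i j = (a i 0 + p i 0 * b j 0) * S i j.
Proof. by rewrite !mxE !big_ord1 !mxE mulr1. Qed.

Lemma diag_col_mulE (R : realType) (n m : nat) (x : 'cV[R]_n)
  (A : 'M[R]_(n, m)) i j : (diag_col x *m A) i j = x i 0 * A i j.
Proof. by rewrite mul_diag_mx !mxE. Qed.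

Lemma tangent_margins (R : realType) (n : nat) (p : 'cV[R]_n) (X : 'M[R]_n) :
  tangent_space p X <-> margins p X = 0.
Proof.
have tr0 : (p^T *m X)^T = X^T *m p by rewrite trmx_mul trmxK.
rewrite /margins -tr0 -col_mx0; split => [[-> ->]|/eq_col_mx[X1 Xp]].
  by rewrite trmx0.
by split=> //; apply: trmx_inj; rewrite Xp trmx0.
Qed.

Lemma marginsB (R : realType) (n : nat) (p : 'cV[R]_n) (X Y : 'M[R]_n) :
  margins p (X - Y) = margins p X - margins p Y.
Proof. by rewrite /margins opp_col_mx add_col_mx linearB /= !mulmxBl. Qed.

Lemma tangent_spaceB (R : realType) (n : nat) (p : 'cV[R]_n) (X Y : 'M[R]_n) :
  tangent_space p X -> tangent_space p Y -> tangent_space p (X - Y).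
Proof.
by move=> /tangent_margins X0 /tangent_margins Y0; apply/tangent_margins;
  rewrite marginsB X0 Y0 subr0.
Qed.

Lemma fisherBl (R : realType) (n : nat) (S X Y W : 'M[R]_n) :
  fisher S (X - Y) W = fisher S X W - fisher S Y W.
Proof.
rewrite /fisher -sumrB; apply: eq_bigr => i _.
by rewrite -sumrB; apply: eq_bigr => j _; rewrite !mxE !mulrBl.
Qed.

Lemma fisher_definite (R : realType) (n : nat) (S X : 'M[R]_n) :
  (forall i j, 0 < S i j) -> fisher S X X = 0 -> X = 0.
Proof.
move=> S_gt0 X0.
have pos i j : 0 <= X i j * X i j / S i j.
  by rewrite divr_ge0 ?(ltW (S_gt0 i j)) // -expr2 sqr_ge0.
apply/matrixP => i j; rewrite mxE.
have /(_ i isT) := psumr_eq0P (fun i _ => sumr_ge0 _ (fun j _ => pos i j)) X0.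
move/(psumr_eq0P (fun j _ => pos i j))/(_ j isT)/eqP.
by rewrite !mulf_eq0 invr_eq0 (gt_eqF (S_gt0 i j)) orbF orbb => /eqP.
Qed.

(** [margins] is the Fisher adjoint of [normal_mx]. *)
Lemma fisher_normal_mx (R : realType) (n : nat) (p : 'cV[R]_n) (S : 'M[R]_n)
  (a b : 'cV[R]_n) (X : 'M[R]_n) : (forall i j, 0 < S i j) ->
  (col_mx a b)^T *m margins p X = (fisher S (normal_mx p S a b) X)%:M.
Proof.
move=> S_gt0; rewrite /margins tr_col_mx mul_row_col [LHS]mx11_scalar.
congr (_%:M); rewrite !mxE /fisher.
under [RHS]eq_bigr => i _.
  under eq_bigr => j _.
    rewrite normal_mxE mulrAC mulfK ?gt_eqF // mulrDl.
    over.
  rewrite big_split /=; over.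
rewrite big_split /=; congr (_ + _); last rewrite exchange_big /=.
  apply: eq_bigr => i _; rewrite !mxE mulr_sumr; apply: eq_bigr => j _.
  by rewrite mxE mulr1.
apply: eq_bigr => j _; rewrite !mxE mulr_sumr; apply: eq_bigr => i _.
by rewrite !mxE; ring.
Qed.

(** The block matrix is the composite of [normal_mx] and [margins]; the
identity in its upper left corner comes from the unit row sums of [S]. *)
Lemma normal_block_mul (R : realType) (n : nat) (p : 'cV[R]_n) (S : 'M[R]_n)
  (a b : 'cV[R]_n) : S *m ones R n = ones R n ->
  normal_block p S *m col_mx a b = margins p (normal_mx p S a b).
Proof.
move=> S1; rewrite /normal_block mul_block_col mul1mx /margins.
congr col_mx; apply/matrixP => i k; rewrite ord1 {k}.
  have rowS : \sum_j S i j = 1.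
    have /matrixP/(_ i 0) := S1; rewrite !mxE => <-.
    by apply: eq_bigr => j _; rewrite mxE mulr1.
  rewrite [LHS]mxE -mulmxA diag_col_mulE [(S *m b) i 0]mxE [RHS]mxE.
  rewrite -[a i 0]mulr1 -rowS !mulr_sumr.
  rewrite -big_split /=; apply: eq_bigr => j _.
  by rewrite normal_mxE mxE; ring.
rewrite [LHS]mxE diag_col_mulE -!mulmxA [RHS]mxE.
rewrite [(S^T *m _) i 0]mxE [X in _ + X * _]mxE mulr_suml -big_split /=.
apply: eq_bigr => j _.
by rewrite !diag_col_mulE [S^T i j]mxE [_^T i j]mxE normal_mxE; ring.
Qed.

(** The block system is margins (Z - N) = 0 with N = [normal_mx p S a b]. *)
Lemma normal_system_tangent (R : realType) (n : nat) (p : 'cV[R]_n)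
  (S Z : 'M[R]_n) (a b : 'cV[R]_n) : S *m ones R n = ones R n ->
  normal_system p S Z a b <-> tangent_space p (Z - normal_mx p S a b).
Proof.
move=> S1; have -> : normal_system p S Z a b =
    (margins p Z = normal_block p S *m col_mx a b) by [].
rewrite normal_block_mul // tangent_margins marginsB.
by split=> [->|/eqP]; [rewrite subrr | rewrite subr_eq0 => /eqP].
Qed.

(** Consistency of the block system. Its solution is determined only up to
the kernel of the matrix, which contains (p, -1). *)
Lemma normal_systemP (R : realType) (n : nat) (p : 'cV[R]_n)
  (S Z : 'M[R]_n) : S *m ones R n = ones R n -> (forall i j, 0 < S i j) ->
  exists a b : 'cV[R]_n, normal_system p S Z a b.
Proof.
move=> S1 S_gt0; set G := normal_block p S.
suff /submxP[c Zc] : ((margins p Z)^T <= G^T)%MS.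
  exists (usubmx c^T), (dsubmx c^T).
  by apply: trmx_inj; rewrite vsubmxK trmx_mul trmxK; exact: Zc.
(* Membership of the right-hand side in the image of G is tested on the columns
   k of the cokernel of G^T, which span the solutions of k^T G = 0. *)
rewrite submxE; apply/eqP/matrixP => i j; rewrite ord1 {i}.
set k := col j (cokermx G^T).
have Gk : k^T *m G = 0.
  apply: trmx_inj; rewrite trmx_mul trmxK /k colE mulmxA mulmx_coker.
  by rewrite mul0mx trmx0.
have kE : k = col_mx (usubmx k) (dsubmx k) by rewrite vsubmxK.
have Ak0 : normal_mx p S (usubmx k) (dsubmx k) = 0.
  apply: (fisher_definite S_gt0); have := fisher_normal_mx p (usubmx k)
    (dsubmx k) (normal_mx p S (usubmx k) (dsubmx k)) S_gt0.
  rewrite -normal_block_mul // -kE mulmxA Gk mul0mx.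
  by move/matrixP/(_ 0 0); rewrite !mxE.
have kZ : k^T *m margins p Z = 0.
  rewrite kE (fisher_normal_mx _ _ _ _ S_gt0) Ak0 -(subrr Z) fisherBl subrr.
  exact: raddf0.
have : ((margins p Z)^T *m k) 0 0 = 0.
  by rewrite -[k]trmxK -trmx_mul kZ !mxE.
by rewrite /k colE mulmxA -colE !mxE.
Qed.

Lemma normal_mx_orthogonal (R : realType) (n : nat) (p : 'cV[R]_n)
  (S X : 'M[R]_n) (a b : 'cV[R]_n) : (forall i j, 0 < S i j) ->
  tangent_space p X -> fisher S (normal_mx p S a b) X = 0.
Proof.
move=> S_gt0 /tangent_margins X0.
have /matrixP/(_ 0 0) := fisher_normal_mx p a b X S_gt0.
by rewrite X0 mulmx0 !mxE.
Qed.

Lemma orthogonal_projection_uniq (R : realType) (n : nat) (p : 'cV[R]_n)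
  (S Z X Y : 'M[R]_n) : (forall i j, 0 < S i j) ->
  tangent_space p X -> (forall W, tangent_space p W -> fisher S (Z - X) W = 0) ->
  tangent_space p Y -> (forall W, tangent_space p W -> fisher S (Z - Y) W = 0) ->
  X = Y.
Proof.
move=> S_gt0 TX oX TY oY; apply/eqP; rewrite -subr_eq0; apply/eqP.
have TXY := tangent_spaceB TX TY; apply: (fisher_definite S_gt0).
have {1}-> : X - Y = (Z - Y) - (Z - X)
  by rewrite opprB [RHS]addrC addrA subrK.
by rewrite fisherBl oX // oY // subrr.
Qed.

Theorem proposition4p3 (R : realType) (n : nat) (p : 'cV[R]_n)
  (p_gt0 : forall i, 0 < p i 0) (p_sum1 : p^T *m ones R n = 1%:M)
  (S : 'M[R]_n) (S_in : stoch_manifold p S) :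
  (exists! Pi : 'M[R]_n -> 'M[R]_n,
     orthogonal_projection (fisher S) (tangent_space p) Pi) /\
  (forall Pi : 'M[R]_n -> 'M[R]_n,
     orthogonal_projection (fisher S) (tangent_space p) Pi ->
     forall Z : 'M[R]_n,
       (exists a b : 'cV[R]_n, normal_system p S Z a b) /\
       (forall a b : 'cV[R]_n, normal_system p S Z a b ->
          Pi Z = Z - hadamard (a *m (ones R n)^T + p *m b^T) S)).
Proof.
case: S_in => S1 _ S_gt0.
have normalP Z a b : normal_system p S Z a b ->
    tangent_space p (Z - normal_mx p S a b) /\
    forall W, tangent_space p W ->
      fisher S (Z - (Z - normal_mx p S a b)) W = 0.
  move=> /(normal_system_tangent _ _ _ _ S1) TZ; split=> // W TW.
  by rewrite subKr normal_mx_orthogonal.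
split; last first.
  move=> Pi PiP Z; split=> [|a b /normalP[TN oN]]; first exact: normal_systemP.
  have [TP oP] := PiP Z; exact: (orthogonal_projection_uniq S_gt0 TP oP TN oN).
have /choice[Pi PiP] : forall Z, exists X, tangent_space p X /\
    forall W, tangent_space p W -> fisher S (Z - X) W = 0.
  move=> Z; have [a [b /normalP ?]] := normal_systemP p Z S1 S_gt0.
  by exists (Z - normal_mx p S a b).
exists Pi; split=> // Pi' Pi'P; apply/funext => Z.
have [[TP oP] [TP' oP']] := (PiP Z, Pi'P Z).
exact: (orthogonal_projection_uniq S_gt0 TP oP TP' oP').
Qed.
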